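(* Let $k=2pq$ for some (not necessarily distinct) primes $p,q$, and let $d=\gcd(p-1,q-1)$. If $d>4$, then $M(k)\le 3$.
   Context: For a positive integer $n$, $\tau(n)$ denotes the number of positive divisors of $n$. For a positive integer $k$, $M(k)$ denotes the maximal length of a run of consecutive positive integers each having exactly $k$ divisors, i.e. the largest $L$ for which there is a positive integer $n$ with $\tau(n)=\tau(n+1)=\dots=\tau(n+L-1)=k$. *)

(* Defs.v *)
From mathcomp Require Import all_boot.
From mathcomp Require Import boolp.

Set Implicit Arguments.
Unset Strict Implicit.
Unset Printing Implicit Defensive.

Definition tau (n : nat) : nat := size (divisors n).

Definition has_run (k L : nat) : Prop :=
  exists2 n : nat, 0 < n & forall i : nat, i < L -> tau (n + i) = k.

Lemma has_run0 (k : nat) : has_run k 0.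
Proof. by exists 1. Qed.

Lemma tau_exp2_dvd (k n : nat) : 0 < n -> 2 ^ k %| n -> k < tau n.
Proof.
move=> n_gt0 dvdkn; rewrite /tau.
have uniq_pow : uniq [seq 2 ^ j | j <- iota 0 k.+1].
  by rewrite map_inj_uniq ?iota_uniq //; apply: expnI.
rewrite -[k.+1](size_iota 0) -(size_map (expn 2)).
apply: uniq_leq_size => // x /mapP[j].
rewrite mem_iota add0n ltnS => /andP[_ lejk] ->.
by rewrite -dvdn_divisors //; apply: dvdn_trans dvdkn; apply: dvdn_exp2l.
Qed.

(* Among 2 ^ k consecutive positive integers one is a multiple of 2 ^ k, hence
   has more than k divisors; so the lengths of runs are bounded. *)
Lemma has_run_bound (k L : nat) : has_run k L -> L <= 2 ^ k.
Proof.
case=> n n_gt0 run_n; rewrite leqNgt; apply/negP=> ltL.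
have pow_gt0 : 0 < 2 ^ k by rewrite expn_gt0.
pose i := 2 ^ k - n %% 2 ^ k.
have lti : i < L by apply: leq_ltn_trans ltL; apply: leq_subr.
have dvdi : 2 ^ k %| n + i.
  rewrite {1}(divn_eq n (2 ^ k)) -addnA subnKC; last by rewrite ltnW ?ltn_mod.
  by rewrite dvdn_add ?dvdn_mull.
have := tau_exp2_dvd (ltn_addr i n_gt0) dvdi.
by rewrite (run_n i lti) ltnn.
Qed.

Lemma ex_has_run (k : nat) : exists L, `[< has_run k L >].
Proof. by exists 0; apply/asboolP/has_run0. Qed.

Lemma ub_has_run (k L : nat) : `[< has_run k L >] -> L <= 2 ^ k.
Proof. by move/asboolP/has_run_bound. Qed.

Definition M (k : nat) : nat := ex_maxn (ex_has_run k) (@ub_has_run k).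

Lemma MP (k : nat) :
  has_run k (M k) /\ forall L, has_run k L -> L <= M k.
Proof.
rewrite /M; case: ex_maxnP => L /asboolP runL maxL; split=> // L' runL'.
by apply: maxL; apply/asboolP.
Qed.

(* Main.v *)
Require Import Defs.
From mathcomp Require Import all_boot.
From mathcomp Require Import zify ring.

(** If tau n = 2pq then every exponent of n, increased by 1, divides 2pq, and
    every divisor c of pq satisfies c = 1 mod d.  Hence at most one exponent of
    n is not a multiple of d, and n is a prime times a d-th power.

    A run of length 4 contains two even numbers that differ by 2, one of them
    2 mod 4 and the other 0 mod 4.  The first is 2 x^d with x odd
    ([twice_odd_tau]).  Let m' be the second and let 2^a be its 2-part.

    If a is odd, then m' = 2 y^d, and x^d and y^d differ by 1: absurd.

    If a is even ([tau_mult4_shape]), then d divides a, and the odd part of m'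
    has twice as many divisors as 1 or a prime, so that it is u t^k with t prime
    and u equal to 1 or a prime.  As d is even, x^d = 1 mod 8, and 16 divides
    m', so m' = 2 x^d - 2.  Write d = 2e, where e >= 3; then
      (x^e - 1) (x^e + 1) = 2^(a-1) u t^k   with a >= 2e,
    which is impossible ([pow_double_neq]) because the left side has too many
    nearly coprime factors.  Indeed the odd parts of x^e - 1 and x^e + 1 are
    coprime, so either one of these numbers is a power of 2, which is an easy
    case of Catalan's equation, or one of them has odd part u, and the other
    has odd part t^k.
    - For even e, x^e - 1 is itself a product of two factors with only one odd
      prime available ([no_split_even_exponent]).
    - For odd e, x - 1 divides x^e - 1 and x + 1 divides x^e + 1 with odd
      cofactors > 1.  On the side of the prime u the cofactor takes up u, so
      x - 1 or x + 1 is a power of 2, and a large one because a >= 2e.  On the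
      side of t^k, half of x + 1 or x - 1 is a power of t which divides the
      larger power of t that is the cofactor; since this cofactor is congruent
      to e, that half divides e, and x is small ([no_split_odd_exponent]). *)

(** * The number of divisors *)

Lemma mem_divisors n c : 0 < n -> (c \in divisors n) = (c %| n).
Proof. by move=> n_gt0; rewrite dvdn_divisors. Qed.

Lemma tau_coprime_mul m n : 0 < m -> 0 < n -> coprime m n ->
  tau (m * n) = tau m * tau n.
Proof.
move=> m_gt0 n_gt0 co_mn; rewrite /tau -(size_allpairs muln).
have gcd_mul a b : a %| m -> b %| n -> gcdn m (a * b) = a.
  by move=> am bn; rewrite Gauss_gcdl ?(coprime_dvdr bn) //; apply/gcdn_idPr.
have gcd_mulr a b : a %| m -> b %| n -> gcdn n (a * b) = b.
  move=> am bn; rewrite Gauss_gcdr; first exact/gcdn_idPr.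
  by rewrite coprime_sym (coprime_dvdl am).
apply/perm_size/uniq_perm; first exact: divisors_uniq.
  apply: allpairs_uniq; rewrite ?divisors_uniq // => x y.
  move=> /allpairsP[[a b] /= [am bn ->]] /allpairsP[[a' b'] /= [am' bn' ->]] /= E.
  move: am bn am' bn'; rewrite !mem_divisors // => am bn am' bn'.
  by rewrite -(gcd_mul a b) // -[in X in (_, X)](gcd_mulr a b) // E
    gcd_mul // gcd_mulr.
move=> c; rewrite mem_divisors ?muln_gt0 ?m_gt0 //.
apply/idP/allpairsP => [dvd_c | [[a b] /= []]]; last first.
  by rewrite !mem_divisors // => am bn ->; apply: dvdn_mul.
have g_gt0 : 0 < gcdn c m by rewrite gcdn_gt0 m_gt0 orbT.
exists (gcdn c m, c %/ gcdn c m); rewrite !mem_divisors //= dvdn_gcdr.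
split=> //; last by rewrite mulnC divnK ?dvdn_gcdl.
rewrite -(@Gauss_dvdr _ (m %/ gcdn c m)).
  rewrite -(dvdn_pmul2l g_gt0) mulnA.
  by rewrite [gcdn c m * (c %/ _)]mulnC [gcdn c m * (m %/ _)]mulnC !divnK
     ?dvdn_gcdl ?dvdn_gcdr.
by rewrite /coprime -(eqn_pmul2l g_gt0) muln1 muln_gcdr
  ![gcdn c m * (_ %/ _)]mulnC !divnK ?dvdn_gcdl ?dvdn_gcdr.
Qed.

Lemma tau_prime_exp r a : prime r -> tau (r ^ a) = a.+1.
Proof.
move=> r_pr; rewrite /tau -[RHS](size_iota 0) -[RHS](size_map (expn r)).
apply/perm_size/uniq_perm; first exact: divisors_uniq.
  by rewrite map_inj_uniq ?iota_uniq //; apply: expnI; apply: prime_gt1.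
move=> c; rewrite mem_divisors ?expn_gt0 ?prime_gt0 //.
apply/(dvdn_pfactor _ _ r_pr)/mapP => -[i]; last by rewrite mem_iota; exists i.
by move=> le_ia ->; exists i; rewrite ?mem_iota.
Qed.

(** One step of the factorization of n: it peels off the prime r completely, so
    that induction on n and case analysis on the factors of tau n can proceed
    together. *)
Lemma tau_prime_factor r n : prime r -> 0 < n -> r %| n ->
  exists a m, [/\ 0 < a, 0 < m, coprime r m, n = r ^ a * m
                & tau n = a.+1 * tau m].
Proof.
move=> r_pr n_gt0 r_n; have [m co_rm def_n] := pfactor_coprime r_pr n_gt0.
exists (logn r n), m.
have m_gt0 : 0 < m by move: n_gt0; rewrite def_n muln_gt0 => /andP[].
split=> //; first by rewrite logn_gt0 mem_primes r_pr n_gt0.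
  by rewrite mulnC.
by rewrite [in LHS]def_n mulnC tau_coprime_mul ?tau_prime_exp ?coprimeXl // expn_gt0
  prime_gt0.
Qed.

Lemma tau_eq1 n : 0 < n -> tau n = 1 -> n = 1.
Proof.
move=> n_gt0 tau1; apply/eqP; rewrite eqn_leq n_gt0 andbT leqNgt.
apply/negP=> n_gt1; have pr := pdiv_prime n_gt1.
have [a [m [a_gt0 _ _ _]]] :=
  tau_prime_factor _ _ pr n_gt0 (pdiv_dvd n).
by rewrite tau1 => /esym/eqP; rewrite muln_eq1; lia.
Qed.

Lemma tau_prime_power n P : 0 < n -> (P = 1) \/ prime P -> tau n = P ->
  exists t k, prime t /\ n = t ^ k.
Proof.
move=> n_gt0 [-> /(tau_eq1 n n_gt0) -> | P_pr tau_n]; first by exists 2, 0.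
have n_gt1 : 1 < n.
  rewrite ltn_neqAle n_gt0 andbT; apply/eqP=> n1.
  by move: P_pr; rewrite -tau_n -n1.
have pr := pdiv_prime n_gt1.
have [a [m [a_gt0 m_gt0 co def_n tau_m]]] :=
  tau_prime_factor _ _ pr n_gt0 (pdiv_dvd n).
exists (pdiv n), a; split=> //.
have a_dv : a.+1 %| P by rewrite -tau_n tau_m dvdn_mulr.
have /(prime_nt_dvdP P_pr) aP : a.+1 != 1 by lia.
rewrite {1}def_n (tau_eq1 m) ?muln1 //.
by have := aP a_dv; have := prime_gt0 P_pr; nia.
Qed.

Lemma tau_eq2 n : 0 < n -> tau n = 2 -> prime n.
Proof.
move=> n_gt0 tau2.
have n_gt1 : 1 < n.
  by rewrite ltn_neqAle n_gt0 andbT; apply/eqP=> n1; move: tau2; rewrite -n1.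
have pr := pdiv_prime n_gt1.
have [a [m [a_gt0 m_gt0 co def_n tau_m]]] :=
  tau_prime_factor _ _ pr n_gt0 (pdiv_dvd n).
have a1 : a = 1.
  have : a.+1 %| 2 by rewrite -tau2 tau_m dvdn_mulr.
  by move/dvdn_leq; lia.
by rewrite def_n (tau_eq1 m) ?a1 ?muln1 //; nia.
Qed.

(** Each exponent a of n has a + 1 dividing tau n, hence k, so d divides a. *)
Lemma expn_of_tau_dvd d k n : (forall c, c %| k -> d %| c.-1) ->
  0 < n -> tau n %| k -> exists y, n = y ^ d.
Proof.
move=> dvd_d; elim/ltn_ind: n => n IH n_gt0 tau_k.
have [n_gt1 | n_le1] := ltnP 1 n; last first.
  by exists 1; rewrite exp1n; lia.
have pr := pdiv_prime n_gt1.
have [a [m [a_gt0 m_gt0 _ def_n tau_m]]] :=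
  tau_prime_factor _ _ pr n_gt0 (pdiv_dvd n).
have /dvdnP[b def_a] : d %| a.+1.-1.
  by apply: dvd_d; apply: dvdn_trans tau_k; rewrite tau_m dvdn_mulr.
have [||y def_m] := IH m _ m_gt0.
- rewrite def_n -[X in X < _]mul1n ltn_pmul2r //.
  by rewrite -{1}(expn0 (pdiv n)) ltn_exp2l ?prime_gt1.
- by apply: dvdn_trans tau_k; rewrite tau_m dvdn_mull.
by exists (pdiv n ^ b * y); rewrite {1}def_n expnMn -expnM -def_m -def_a.
Qed.

Lemma dvdn_prime_mul p q c : prime p -> prime q -> c %| p * q ->
  [\/ c = 1, c = p, c = q | c = p * q].
Proof.
move=> p_pr q_pr; have [/dvdnP[b ->] | ] := boolP (p %| c).
  rewrite mulnC dvdn_pmul2l ?prime_gt0 //.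
  case/primeP: q_pr => _ q_dv /q_dv /orP[] /eqP ->; first by constructor 2; rewrite muln1.
  by constructor 4.
rewrite -prime_coprime // coprime_sym => co; rewrite Gauss_dvdr //.
by case/primeP: q_pr => _ q_dv /q_dv /orP[] /eqP ->; [constructor 1 | constructor 3].
Qed.

(** The exponents of n, increased by 1, are the factors of a factorization of
    2 B.  There are at most two of them, and if there are two then one is 2,
    which stands for a prime u that occurs to the first power.  The case u = 1
    covers prime powers. *)
Lemma tau_double_prime n B : 0 < n -> (B = 1) \/ prime B -> tau n = 2 * B ->
  exists u t k, [/\ u = 1 \/ prime u, prime t & n = u * t ^ k].
Proof.
move=> n_gt0 B_pr tau_n.
have n_gt1 : 1 < n.
  rewrite ltn_neqAle n_gt0 andbT; apply/eqP=> n1.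
  by move: tau_n; rewrite -n1 /tau /=; lia.
have pr := pdiv_prime n_gt1; set r := pdiv n in pr.
have B_gt0 : 0 < B by case: B_pr => [-> | /prime_gt0].
have [a [m [a_gt0 m_gt0 co def_n tau_m]]] :=
  tau_prime_factor _ _ pr n_gt0 (pdiv_dvd n).
rewrite -/r in co def_n.
have tau_m_dv : tau m %| 2 * B by rewrite -tau_n tau_m dvdn_mull.
have tau_m_cases : [\/ tau m = 1, tau m = 2, tau m = B | tau m = 2 * B].
  case: B_pr tau_m_dv => [-> | B_pr]; last exact: dvdn_prime_mul.
  have /primeP[_ dvd2] : prime 2 by [].
  by rewrite muln1 => /dvd2 /orP[] /eqP ->; [constructor 1 | constructor 2].
case: tau_m_cases => E.
- exists 1, r, a; rewrite def_n (tau_eq1 m) // mul1n muln1.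
  by split=> //; left.
- exists m, r, a; rewrite mulnC; split=> //.
  by right; apply: tau_eq2.
- have a1 : a = 1.
    apply/eqP; rewrite -eqSS -(eqn_pmul2r B_gt0); apply/eqP.
    by rewrite -[in LHS]E -tau_m tau_n.
  have [t [k [t_pr def_m]]] := tau_prime_power m B m_gt0 B_pr E.
  exists r, t, k; rewrite {1}def_n a1 expn1 -def_m.
  by split=> //; right.
have : 1 * (2 * B) < a.+1 * (2 * B) by rewrite ltn_pmul2r ?muln_gt0.
by rewrite -[X in _ < _ * X]E -tau_m tau_n mul1n ltnn.
Qed.

(** * The factors of x^e - 1 and x^e + 1 *)

(** The geometric sums C = 1 + x + ... + x^(2f) and
    D = 1 - x + ... + x^(2f).  They have an odd number of odd terms, and each
    term is 1 modulo x - 1 or x + 1 respectively.  The recurrences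
    C' = x^2 C + x + 1 and D' = x^2 D - (x - 1) give both without signed sums. *)
Lemma odd_exponent_cofactors x f : 1 < x -> odd x ->
  exists C D, [/\ x ^ f.*2.+1 = (x - 1) * C + 1 /\ x ^ f.*2.+1 + 1 = (x + 1) * D,
    odd C /\ odd D, C = f.*2.+1 %[mod x - 1] /\ D = f.*2.+1 %[mod x + 1]
    & 0 < f -> x < C /\ x < D].
Proof.
move=> x_gt1 odd_x; elim: f => [|f [C [D [[EC ED] [oC oD] [mC mD] _]]]].
  by exists 1, 1; split=> //; split; lia.
have D_gt0 : 0 < D by case: (D) oD.
have C_gt0 : 0 < C by case: (C) oC.
case: x x_gt1 odd_x EC ED mC mD => // y; rewrite subn1 /= => y_gt0 odd_x EC ED mC mD.
have y_le : y <= y.+1 ^ 2 * D.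
  apply: leq_trans (leq_pmulr _ D_gt0); apply: leq_trans (leqnSn y) _.
  by rewrite expnS expn1 leq_pmulr.
exists (y.+1 ^ 2 * C + y.+1 + 1), (y.+1 ^ 2 * D - y).
have S : f.+1.*2.+1 = f.*2.+1 + 2 by lia.
rewrite S expnD; split.
- split; first by rewrite EC; ring.
  apply: (@addIn ((y.+1 + 1) * y)); rewrite mulnBr subnK ?leq_mul2l ?y_le ?orbT //.
  by rewrite mulnCA -ED; ring.
- by rewrite oddB // !(oddD, oddM, oddX) oC oD /=; move: odd_x => /= /negbTE ->.
- split.
  + have -> : y.+1 ^ 2 * C + y.+1 + 1 = (y.+2 * C + 1) * y + (C + 2) by ring.
    by rewrite modnMDl -modnDml mC modnDml.
  + apply/eqP; rewrite -(eqn_modDr y) subnK //; apply/eqP.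
    have -> : y.+1 ^ 2 * D = (y * D) * (y.+1 + 1) + D by ring.
    have -> : f.*2.+1 + 2 + y = 1 * (y.+1 + 1) + f.*2.+1 by lia.
    by rewrite !modnMDl.
move=> _; split.
  rewrite -addnA ltn_addl // addn1 ltnS; by [].
rewrite ltn_subRL; apply: leq_trans (leq_pmulr _ D_gt0).
have -> : y.+1 ^ 2 = (y + y.+1) + y * y by ring.
by rewrite -[X in X < _]addn0 ltn_add2l muln_gt0 andbb.
Qed.

Lemma odd_dvd_pow2 n a : odd n -> n %| 2 ^ a -> n = 1.
Proof.
move=> odd_n n_dv; apply/eqP; rewrite -dvdn1 -(@Gauss_dvdl n 1 (2 ^ a)) ?mul1n //.
by rewrite coprimeXr // coprimen2.
Qed.

Lemma odd_sqr_mod8 x : odd x -> x ^ 2 = 1 %[mod 8].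
Proof.
move=> odd_x; rewrite -(odd_double_half x) odd_x.
move: x./2 => h.
have : 2 %| h * h.+1 by rewrite dvdn2 oddM /=; case: (odd h).
by case/dvdnP=> c Ec; rewrite (_ : (_ ^ 2) = c * 8 + 1) ?modnMDl //; nia.
Qed.

Lemma odd_pow_even_mod8 x f : odd x -> x ^ f.*2 = 1 %[mod 8].
Proof.
by move=> odd_x; rewrite -mul2n expnM -modnXm odd_sqr_mod8 // modnXm exp1n.
Qed.

(** For odd e the cofactor of x + 1 is an odd divisor of 2^a that exceeds 1; for
    even e, x^e + 1 is 2 mod 8 and exceeds 2. *)
Lemma succ_pow_neq_pow2 x e a : 1 < x -> odd x -> 1 < e -> x ^ e + 1 <> 2 ^ a.
Proof.
move=> x_gt1 odd_x e_gt1 E.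
have X_ge : x ^ 2 <= x ^ e by rewrite leq_exp2l.
case: (boolP (odd e)) => odd_e.
  have [C [D [[_ ED] [_ oD] _ gtD]]] :=
    odd_exponent_cofactors x e./2 x_gt1 odd_x.
  have e_def : e./2.*2.+1 = e by rewrite -[RHS]odd_double_half odd_e.
  have e2_gt0 : 0 < e./2 by lia.
  have D1 : D = 1 by apply: (odd_dvd_pow2 D a oD); rewrite -E -e_def ED dvdn_mull.
  by have [_] := gtD e2_gt0; lia.
have := odd_pow_even_mod8 x e./2 odd_x.
rewrite -[X in x ^ X](odd_double_half e) (negbTE odd_e) add0n in E X_ge => M8.
have {}X_ge : 4 <= x ^ e./2.*2 by apply: leq_trans X_ge; rewrite -[4]/(2 ^ 2) leq_exp2r.
case: a E => [|[|a]]; rewrite ?expn0 ?expn1 ?expnS; lia.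
Qed.

(** Odd e is excluded by the cofactor of x - 1.  For e = 2f both x^f - 1 and
    x^f + 1 are powers of 2, so the preceding lemma forces f = 1, and then 2
    and 4 are the only powers of 2 at distance 2. *)
Lemma pred_pow_eq_pow2 x e a : 1 < x -> odd x -> 1 < e -> x ^ e = 2 ^ a + 1 ->
  x = 3 /\ e = 2.
Proof.
move=> x_gt1 odd_x e_gt1 E.
case: (boolP (odd e)) => odd_e.
  have [C [D [[EC _] [oC _] _ gtC]]] :=
    odd_exponent_cofactors x e./2 x_gt1 odd_x.
  have e_def : e./2.*2.+1 = e by rewrite -[RHS]odd_double_half odd_e.
  have e2_gt0 : 0 < e./2 by lia.
  have C1 : C = 1.
    apply: (odd_dvd_pow2 C a oC).
    have -> : 2 ^ a = (x - 1) * C by rewrite e_def in EC; lia.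
    by rewrite dvdn_mull.
  by have [] := gtC e2_gt0; lia.
have e_def : e = e./2.*2 by rewrite -[LHS]odd_double_half (negbTE odd_e).
move: e_def; move: (e./2) => f e_def.
have F : (x ^ f - 1) * (x ^ f + 1) = 2 ^ a.
  have : x ^ e = x ^ f * x ^ f by rewrite e_def -addnn expnD.
  by have : 0 < x ^ f; [rewrite expn_gt0; lia | nia].
have [f1 | f_gt1] : f = 1 \/ 1 < f by lia.
  move: F; rewrite f1 expn1 => F.
  have /(dvdn_pfactor _ _ (isT : prime 2))[b _ Eb] : x - 1 %| 2 ^ a
    by rewrite -F dvdn_mulr.
  have /(dvdn_pfactor _ _ (isT : prime 2))[c _ Ec] : x + 1 %| 2 ^ a
    by rewrite -F dvdn_mull.
  split; last lia.
  case: b Eb => [|[|b]]; rewrite ?expn0 ?expn1; try by lia.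
  case: c Ec => [|[|c]]; rewrite ?expn0 ?expn1; try by lia.
  by rewrite !expnS; lia.
have /(dvdn_pfactor _ _ (isT : prime 2))[c _ Ec] : x ^ f + 1 %| 2 ^ a
  by rewrite -F dvdn_mull.
by have := succ_pow_neq_pow2 _ _ _ x_gt1 odd_x f_gt1 Ec.
Qed.

(** * Factorizations of x^(2e) - 1 with two odd primes *)

Lemma pow2_mul_odd_inj i j m n : odd m -> odd n -> 2 ^ i * m = 2 ^ j * n ->
  i = j /\ m = n.
Proof.
move=> odd_m odd_n E.
have log2 k l : odd l -> logn 2 (2 ^ k * l) = k.
  by move=> odd_l; rewrite lognM ?expn_gt0 ?(odd_gt0 odd_l) // pfactorK // logn_coprime
    ?coprime2n ?addn0.
have ij : i = j by rewrite -(log2 i m) // E log2.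
by split=> //; apply/eqP; rewrite -(eqn_pmul2l (expn_gt0 2 i)) E ij.
Qed.

Lemma coprime_prime_mul_power U V u t k : 0 < U -> 0 < V -> coprime U V ->
    (u = 1 \/ prime u) -> prime t -> U * V = u * t ^ k ->
  [\/ U = 1, V = 1, prime u /\ (U = u /\ V = t ^ k)
    | prime u /\ (U = t ^ k /\ V = u)].
Proof.
move=> U_gt0 V_gt0 co u_pr t_pr E.
have dvd_u W : W %| u -> W = 1 \/ (W = u /\ prime u).
  case: u_pr => [-> | pr_u]; first by rewrite dvdn1 => /eqP; left.
  by case/primeP: (pr_u) => _ dv /dv /orP[] /eqP; [left | right].
have [t_U | t_U] := boolP (t %| U).
  have co_V : coprime V (t ^ k).
    by rewrite coprimeXr // coprime_sym; apply: coprime_dvdl t_U co.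
  have V_u : V %| u by rewrite -(Gauss_dvdl u co_V) -E dvdn_mull.
  case: (dvd_u V V_u) => [-> | [Vu pr_u]]; first by constructor 2.
  constructor 4; split=> //; split=> //.
  by apply/eqP; rewrite -(eqn_pmul2l V_gt0) mulnC E Vu.
have co_U : coprime U (t ^ k) by rewrite coprimeXr // coprime_sym prime_coprime.
have U_u : U %| u by rewrite -(Gauss_dvdl u co_U) -E dvdn_mulr.
case: (dvd_u U U_u) => [-> | [Uu pr_u]]; first by constructor 1.
constructor 3; split=> //; split=> //.
by apply/eqP; rewrite -(eqn_pmul2l U_gt0) E Uu.
Qed.

Lemma odd_cofactor_of_prime w D a u : prime u -> odd D -> 1 < D ->
  w * D = 2 ^ a * u -> w = 2 ^ a.
Proof.
move=> u_pr odd_D D_gt1 E.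
have D_u : D %| u.
  by rewrite -(@Gauss_dvdr D (2 ^ a)) ?coprimeXr ?coprimen2 // -E dvdn_mull.
have /(prime_nt_dvdP u_pr)/(_ D_u) Du : D != 1 by rewrite neq_ltn D_gt1 orbT.
by apply/eqP; rewrite -(eqn_pmul2r (ltnW D_gt1)) E Du.
Qed.

(** The number w / 2 and its cofactor D are both powers of t, and D is the
    larger one, so w / 2 divides D.  Since w / 2 also divides D - e, it divides e. *)
Lemma cofactor_of_prime_power w D e t k : prime t -> 0 < e ->
  ~~ odd w -> w <= D -> D = e %[mod w] -> w * D = 2 * t ^ k -> w <= 2 * e.
Proof.
move=> t_pr e_gt0 even_w w_le mod_D E.
have def_w : w = 2 * w./2 by rewrite mul2n -[LHS]odd_double_half (negbTE even_w).
move: (w./2) def_w => h def_w.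
have {}E : h * D = t ^ k by apply/eqP; rewrite -(eqn_pmul2l (isT : 0 < 2)) mulnA -def_w E.
have /(dvdn_pfactor _ _ t_pr)[c _ h_c] : h %| t ^ k by rewrite -E dvdn_mulr.
have /(dvdn_pfactor _ _ t_pr)[j _ D_j] : D %| t ^ k by rewrite -E dvdn_mull.
have h_D : h %| D.
  rewrite h_c D_j dvdn_exp2l // -(leq_exp2l _ _ (prime_gt1 t_pr)) -h_c -D_j.
  by apply: leq_trans w_le; rewrite def_w leq_pmull.
have h_w : h %| w by rewrite def_w dvdn_mull.
have : h %| e by rewrite /dvdn -(modn_dvdm e h_w) -mod_D modn_dvdm.
by move/dvdn_leq; rewrite def_w leq_mul2l; apply.
Qed.

(** The size contradiction of [no_split_odd_exponent] when x + 1 = 2^m: there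
    x - 1 <= 2e and m >= 2e - 2, hence 2^m <= m + 4. *)
Lemma addn4_ltn_exp2 m : 3 < m -> m + 4 < 2 ^ m.
Proof.
case: m => [|[|m]] // m_gt1; rewrite !expnS.
by have := ltn_expl m (isT : 1 < 2); lia.
Qed.

(** Two multiples of 4 cannot differ by 2. *)
Lemma pow2_gap a b U V : odd V -> 0 < a -> 2 ^ b * V = 2 ^ a * U + 2 ->
  a = 1 \/ b = 1.
Proof.
move=> odd_V a_gt0 E.
have b_gt0 : 0 < b.
  rewrite lt0n; apply/negP=> /eqP b0; move: (congr1 odd E).
  by rewrite b0 mul1n odd_V oddD oddM oddX (gtn_eqF a_gt0).
case: a b E a_gt0 b_gt0 => [|[|a]] [|[|b]] //; [by left | by left | by right |].
by rewrite !expnS; lia.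
Qed.

(** The cofactor on the side of u is u itself, so x - 1 or x + 1 is the exact
    power of 2 there.  One of a and b is 1; if the power of 2 just found is the
    trivial one, then x = 3, excluded modulo 8, or x = 1; otherwise it is at
    least 2^(2e - 2), where e = 2f + 1, while [cofactor_of_prime_power] on the
    other side gives x <= 2e + 1. *)
Lemma no_split_odd_exponent x f a b U V u t k : 1 < x -> odd x -> 0 < f ->
    2 * f.*2.+1 <= (a + b).+1 -> odd U -> odd V ->
    x ^ f.*2.+1 = 2 ^ a * U + 1 -> x ^ f.*2.+1 + 1 = 2 ^ b * V ->
    prime u -> prime t ->
  (U = u /\ V = t ^ k) \/ (U = t ^ k /\ V = u) -> False.
Proof.
move=> x_gt1 odd_x f_gt0 le_ab odd_U odd_V EU EV u_pr t_pr UV.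
have ab : a = 1 \/ b = 1.
  apply: (@pow2_gap a b U V) => //; last by rewrite -EV EU -addnA.
  rewrite lt0n; apply/negP=> /eqP a0; move: (congr1 odd EU).
  by rewrite a0 mul1n oddX odd_x oddD odd_U.
have [C [D [[EC ED] [oC oD] [mC mD] /(_ f_gt0)[gtC gtD]]]] :=
  odd_exponent_cofactors x f x_gt1 odd_x.
have C_gt1 : 1 < C by apply: ltn_trans gtC.
have D_gt1 : 1 < D by apply: ltn_trans gtD.
have {}EC : (x - 1) * C = 2 ^ a * U by apply: (@addIn 1); rewrite -EC.
have {}ED : (x + 1) * D = 2 ^ b * V by rewrite -ED.
case: UV => [[Uu Vt] | [Ut Vu]].
  have xa : x - 1 = 2 ^ a.
    by apply: (@odd_cofactor_of_prime _ C _ u); rewrite // EC Uu.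
  case: ab => [a1 | b1].
    have x3 : x = 3 by clear - xa a1 x_gt1; rewrite a1 in xa; lia.
    have M8 := odd_pow_even_mod8 3 f isT.
    (* As 3^(2f+1) + 1 is 4 mod 8, b cannot exceed 2. *)
    have b_gt2 : 2 < b by clear - a1 le_ab f_gt0; lia.
    move: EV; rewrite x3 -(subnKC b_gt2) expnD -mulnA expnS.
    by clear - M8; lia.
  have le_x : x + 1 <= 2 * f.*2.+1.
    apply: (@cofactor_of_prime_power _ D _ t k); rewrite // ?ED ?b1 ?Vt //.
    - by rewrite oddD odd_x.
    - by rewrite addn1.
  have := ltn_expl a (isT : 1 < 2).
  by clear - xa le_x b1 le_ab; lia.
have xb : x + 1 = 2 ^ b.
  by apply: (@odd_cofactor_of_prime _ D _ u); rewrite // ED Vu.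
case: ab => [a1 | b1]; last by clear - xb b1 x_gt1; rewrite b1 in xb; lia.
have le_x : x - 1 <= 2 * f.*2.+1.
  apply: (@cofactor_of_prime_power _ C _ t k); rewrite // ?EC ?a1 ?Ut //.
  - by rewrite oddB ?odd_x // ltnW.
  - by rewrite leq_subLR (leq_trans (ltnW gtC)) // leq_addl.
have := @addn4_ltn_exp2 b.
by clear - xb le_x a1 le_ab f_gt0; lia.
Qed.

(** A prime s other than 2 divides at most one of two numbers that differ by 2,
    and the other one divides 2^i; for s = 2 every divisor is a power of 2. *)
Lemma pow2_of_mul_add2 a i s j : prime s -> a * (a + 2) = 2 ^ i * s ^ j ->
  exists c, a = 2 ^ c \/ a + 2 = 2 ^ c.
Proof.
move=> s_pr E.
have pow2 m l : m %| 2 ^ l -> exists c, m = 2 ^ c.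
  by case/(dvdn_pfactor _ _ (isT : prime 2)) => c _ ->; exists c.
have [s2 | s2] := eqVneq s 2.
  have [c Ec] : exists c, a = 2 ^ c.
    by apply: (pow2 a (i + j)); rewrite expnD -[in 2 ^ j]s2 -E dvdn_mulr.
  by exists c; left.
have [s_a | s_a] := boolP (s %| a).
  have s_a2 : ~~ (s %| a + 2) by rewrite dvdn_addr // dvdn_prime2.
  have [c Ec] : exists c, a + 2 = 2 ^ c.
    apply: (pow2 _ i); rewrite -(@Gauss_dvdl _ _ (s ^ j)) -?E ?dvdn_mull //.
    by rewrite coprimeXr // coprime_sym prime_coprime.
  by exists c; right.
have [c Ec] : exists c, a = 2 ^ c.
  apply: (pow2 _ i); rewrite -(@Gauss_dvdl _ _ (s ^ j)) -?E ?dvdn_mulr //.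
  by rewrite coprimeXr // coprime_sym prime_coprime.
by exists c; left.
Qed.

(** Here x^e + 1 is 2 mod 8 for e = 2f, so b <= 1 and the bound on a + b makes a
    large.  One of x^f - 1 and x^f + 1 is a power of 2, which leaves only
    3^4 - 1 = 2^4 * 5, where a is too small. *)
Lemma no_split_even_exponent x f a b s j V : 1 < x -> odd x -> 1 < f ->
    2 * f.*2 <= (a + b).+1 -> prime s ->
    x ^ f.*2 = 2 ^ a * s ^ j + 1 -> x ^ f.*2 + 1 = 2 ^ b * V -> False.
Proof.
move=> x_gt1 odd_x f_gt1 le_ab s_pr EU EV.
have M8 := odd_pow_even_mod8 x f odd_x.
have b_le1 : b <= 1.
  by case: b EV {le_ab} => [|[|b]] //; rewrite !expnS; lia.
have xf_gt0 : 0 < x ^ f by rewrite expn_gt0 ltnW.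
have [c] : exists c, x ^ f - 1 = 2 ^ c \/ x ^ f - 1 + 2 = 2 ^ c.
  apply: (@pow2_of_mul_add2 _ a s j) => //.
  have -> : 2 ^ a * s ^ j = x ^ f.*2 - 1 by lia.
  rewrite -addnn expnD; case: (x ^ f) xf_gt0 => // y _; rewrite subn1 /=.
  by apply: (@addIn 1); rewrite subnK ?muln_gt0 //; ring.
case=> Ec; last first.
  by apply: (succ_pow_neq_pow2 x f c) => //; lia.
have [] := pred_pow_eq_pow2 x f c x_gt1 odd_x f_gt1; first by lia.
move=> x3 f2; move: EU le_ab; rewrite x3 f2 /= => EU le_ab.
have : 2 ^ 6 %| 80.
  have -> : 80 = 2 ^ a * s ^ j by lia.
  by rewrite dvdn_mulr // dvdn_exp2l //; lia.
by [].
Qed.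

(** The lower bound on a is essential: 3^8 - 1 = 2^5 * 5 * 41. *)
Lemma pow_double_neq x e a u t k : 1 < x -> odd x -> 2 < e -> 2 * e <= a ->
    (u = 1 \/ prime u) -> prime t -> odd (u * t ^ k) ->
  x ^ (2 * e) <> 2 ^ a.-1 * (u * t ^ k) + 1.
Proof.
move=> x_gt1 odd_x e_gt2 le_a u_pr t_pr odd_o E.
set X := x ^ e; have X_gt2 : 2 < X.
  by apply: (@leq_ltn_trans x) => //; rewrite -[x in x < _]expn1 ltn_exp2l // ltnW.
have X1_gt0 : 0 < X - 1 by lia.
have [U co_U EU] := pfactor_coprime (isT : prime 2) X1_gt0.
have [V co_V EV] := pfactor_coprime (isT : prime 2) (isT : 0 < X.+1).
move: (logn 2 _) (logn 2 _) EU EV => be al EU EV.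
rewrite !coprime2n in co_U co_V.
have EX : (X - 1) * X.+1 + 1 = x ^ (2 * e).
  rewrite [2 * e]mulnC expnM -/X; case: (X) X_gt2 => // y _; rewrite subn1 /=; ring.
have [ab UV] : al + be = a.-1 /\ U * V = u * t ^ k.
  apply: pow2_mul_odd_inj => //; first by rewrite oddM co_U.
  by apply: (@addIn 1); rewrite -E -EX EU EV expnD; ring.
have co_UV : coprime U V.
  have g_odd : odd (gcdn U V) by apply: dvdn_odd co_U; apply: dvdn_gcdl.
  have : gcdn U V %| 2.
    rewrite -(@dvdn_addr (X - 1)); last by rewrite EU dvdn_mulr // dvdn_gcdl.
    have -> : X - 1 + 2 = X.+1 by lia.
    by rewrite EV dvdn_mulr // dvdn_gcdr.
  have /primeP[_ dv2] : prime 2 by [].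
  by case/dv2/orP=> // /eqP g2; rewrite g2 in g_odd.
have {}EU : x ^ e = 2 ^ al * U + 1 by rewrite -/X mulnC -EU; lia.
have {}EV : x ^ e + 1 = 2 ^ be * V by rewrite -/X mulnC -EV addn1.
have prime_case : prime u -> (U = u /\ V = t ^ k) \/ (U = t ^ k /\ V = u) -> False.
  move=> pr_u UVut; have le_ab : 2 * e <= (al + be).+1 by lia.
  have [odd_e | even_e] := boolP (odd e).
    have def_e : e = e./2.*2.+1 by rewrite -[LHS]odd_double_half odd_e.
    rewrite def_e in EU EV le_ab.
    by apply: (no_split_odd_exponent x e./2 al be U V u t k) => //; lia.
  have def_e : e = e./2.*2 by rewrite -[LHS]odd_double_half (negbTE even_e).
  rewrite def_e in EU EV le_ab.
  have f_gt1 : 1 < e./2 by lia.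
  case: UVut => [[Uu Vt] | [Ut Vu]].
    by apply: (no_split_even_exponent x e./2 al be u 1 V); rewrite ?expn1 -?Uu // Uu.
  by apply: (no_split_even_exponent x e./2 al be t k V); rewrite -?Ut.
case: (coprime_prime_mul_power U V u t k _ _ co_UV u_pr t_pr UV); rewrite ?odd_gt0 //.
- move=> U1; have [] := pred_pow_eq_pow2 x e al x_gt1 odd_x; first by lia.
    by rewrite EU U1 muln1.
  by move=> _ e2; rewrite e2 in e_gt2.
- move=> V1; apply: (succ_pow_neq_pow2 x e be) => //; first by lia.
  by rewrite EV V1 muln1.
- by case=> pr_u UVE; apply: prime_case => //; left.
- by case=> pr_u UVE; apply: prime_case => //; right.
Qed.

(** * Even members of a run *)

Lemma twice_odd_tau d k m : (forall c, c %| k -> d %| c.-1) -> 0 < d ->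
  odd m -> tau (2 * m) = 2 * k -> exists2 x, m = x ^ d & odd x.
Proof.
move=> dvd_d d_gt0 odd_m tau_m.
have m_gt0 := odd_gt0 odd_m.
have tau_k : tau m = k.
  apply/eqP; rewrite -(eqn_pmul2l (isT : 0 < 2)) -tau_m tau_coprime_mul ?coprime2n //.
have [|x Ex] := expn_of_tau_dvd d k m dvd_d m_gt0; first by rewrite tau_k.
by exists x => //; move: odd_m; rewrite Ex oddX (gtn_eqF d_gt0).
Qed.

(** With 2^a the 2-part of m, the factor 2 of tau m = 2pq belongs either to
    a + 1 or to the number of divisors of the odd part. *)
Lemma tau_mult4_shape p q d m : prime p -> prime q -> odd p -> odd q ->
    (forall c, c %| p * q -> d %| c.-1) ->
    0 < m -> 4 %| m -> tau m = 2 * (p * q) ->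
  (exists y, m = 2 * y ^ d) \/
  (exists a u t k, [/\ d <= a, u = 1 \/ prime u, prime t, odd (u * t ^ k)
                     & m = 2 ^ a * (u * t ^ k)]).
Proof.
move=> p_pr q_pr odd_p odd_q dvd_d m_gt0 m4 tau_m.
have [|a [o [a_gt0 o_gt0 odd_o def_m tau_o]]] := tau_prime_factor 2 m isT m_gt0.
  by apply: dvdn_trans m4.
rewrite coprime2n in odd_o.
have a_gt1 : 1 < a.
  rewrite ltn_neqAle a_gt0 andbT; apply/eqP=> a1; move: m4.
  by rewrite def_m -a1 (dvdn_pmul2l (p := 2) (d := 2)) // dvdn2 odd_o.
have [odd_a | even_a] := boolP (odd a).
  left; have def_a : a.+1 = 2 * a.+1./2.
    by rewrite mul2n -[LHS]odd_double_half /= odd_a.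
  have pq : a.+1./2 * tau o = p * q.
    by apply/eqP; rewrite -(eqn_pmul2l (isT : 0 < 2)) mulnA -def_a -tau_o tau_m.
  have /dvdnP[c Ec] : d %| (a.+1./2).-1 by apply: dvd_d; rewrite -pq dvdn_mulr.
  have [|z Ez] := expn_of_tau_dvd d (p * q) o dvd_d o_gt0; first by rewrite -pq dvdn_mull.
  (* Here a + 1 = 2A with A = cd + 1, so a = 2cd + 1. *)
  exists (2 ^ (2 * c) * z).
  have {}def_a : a = (2 * c * d).+1 by clear - def_a Ec a_gt1; lia.
  by rewrite def_m {1}def_a expnMn -expnM -Ez expnS mulnA.
right; have co_a : coprime a.+1 2 by rewrite coprimen2 /= even_a.
have a_pq : a.+1 %| p * q by rewrite -(Gauss_dvdr _ co_a) -tau_m tau_o dvdn_mulr.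
have d_le_a : d <= a by apply: (dvdn_leq a_gt0); apply: (dvd_d a.+1).
case/dvdnP: (a_pq) => b Eb.
have tau_o2 : tau o = 2 * b.
  apply/eqP; rewrite -(eqn_pmul2l (ltn0Sn a)) -tau_o tau_m Eb.
  by rewrite [b * _]mulnC mulnCA.
have b_pr : b = 1 \/ prime b.
  have pq_gt0 : 0 < p * q by rewrite muln_gt0 !prime_gt0.
  have b_pq : b %| p * q by rewrite Eb dvdn_mulr.
  case: (dvdn_prime_mul p q b p_pr q_pr b_pq) => Hb; [by left | by right; rewrite Hb.. |].
  by move: Eb pq_gt0; rewrite -Hb; clear - a_gt1; case: b => // b; nia.
have [u [t [k [u_pr t_pr Eo]]]] := tau_double_prime o b o_gt0 b_pr tau_o2.
by exists a, u, t, k; rewrite -Eo.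
Qed.

Lemma succ_pow_neq_pow d x y : 1 < d -> 0 < x -> 0 < y -> x ^ d + 1 <> y ^ d.
Proof.
move=> d_gt1 x_gt0 y_gt0 E.
have lt_xy : x < y by rewrite -(ltn_exp2r x y (ltnW d_gt1)) -E addn1.
have : x.+1 ^ d <= x ^ d + 1 by rewrite E leq_exp2r // ltnW.
rewrite -(prednK (ltnW d_gt1)) !expnS.
have : 1 < x.+1 ^ d.-1 by rewrite -{1}(expn0 x.+1) ltn_exp2l // -ltnS prednK // ltnW.
have : x ^ d.-1 <= x.+1 ^ d.-1 by rewrite leq_exp2r // -ltnS prednK // ltnW.
by clear; rewrite mulSn; nia.
Qed.

(** The half of n or the half of n + 2 is odd, and this m is a d-th power x^d.
    The other number m' is 2m + 2 or 2m - 2. *)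
Lemma no_even_pair p q d n : prime p -> prime q -> d = gcdn (p - 1) (q - 1) ->
  4 < d -> 0 < n -> ~~ odd n -> tau n = 2 * (p * q) ->
  tau (n + 2) = 2 * (p * q) -> False.
Proof.
move=> p_pr q_pr def_d d_gt4 n_gt0 even_n tau_n tau_n2.
have d_p : d %| p - 1 by rewrite def_d dvdn_gcdl.
have d_q : d %| q - 1 by rewrite def_d dvdn_gcdr.
have odd_of r : prime r -> d %| r - 1 -> odd r.
  move=> r_pr d_r; case: (even_prime r_pr) d_r => // ->.
  by rewrite dvdn1 => /eqP d1; rewrite d1 in d_gt4.
have odd_p := odd_of p p_pr d_p; have odd_q := odd_of q q_pr d_q.
have dvd_d c : c %| p * q -> d %| c.-1.
  case/(dvdn_prime_mul p q c p_pr q_pr) => ->; rewrite -?subn1 ?dvdn0 //.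
  have -> : p * q - 1 = (p - 1) * q + (q - 1).
    by rewrite mulnBl mul1n addnBA ?prime_gt0 // subnK // leq_pmull ?prime_gt0.
  by rewrite dvdn_add // dvdn_mulr.
have d_def : d = 2 * d./2.
  have : 2 %| d by rewrite def_d dvdn_gcd !dvdn2 !oddB ?prime_gt0 // odd_p odd_q.
  by rewrite dvdn2 mul2n => /negbTE even_d; rewrite -[LHS]odd_double_half even_d.
have e_gt2 : 2 < d./2 by lia.
suff main m m' : odd m -> tau (2 * m) = 2 * (p * q) -> 0 < m' -> 4 %| m' ->
    tau m' = 2 * (p * q) -> m' = 2 * m + 2 \/ m' + 2 = 2 * m -> False.
  have def_n : n = 2 * n./2 by rewrite mul2n -[LHS]odd_double_half (negbTE even_n).
  have [odd_h | even_h] := boolP (odd n./2).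
    apply: (main n./2 (n + 2)); rewrite -?def_n //; last by left.
    - by rewrite addn2.
    - by rewrite def_n -[X in _ + X]muln1 -mulnDr (dvdn_pmul2l (p := 2) (d := 2)) //
        dvdn2 oddD odd_h.
  have def_n2 : n + 2 = 2 * n./2.+1 by rewrite mulnS addnC -def_n.
  apply: (main n./2.+1 n); rewrite -?def_n2 //; last by right.
  by rewrite def_n (dvdn_pmul2l (p := 2) (d := 2)) // dvdn2.
move=> odd_m tau_m m'_gt0 m'4 tau_m' mm'.
have d_gt1 : 1 < d by apply: ltn_trans d_gt4.
have [x def_m odd_x] := twice_odd_tau d (p * q) m dvd_d (ltnW d_gt1) odd_m tau_m.
have M8 : m = 1 %[mod 8] by rewrite def_m d_def mul2n odd_pow_even_mod8.
case: (tau_mult4_shape p q d m') => //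
    [[y def_m'] | [a [u [t [k [d_a u_pr t_pr odd_o def_m']]]]]].
  have y_gt0 : 0 < y.
    rewrite lt0n; apply/negP=> /eqP y0; move: m'_gt0.
    by rewrite def_m' y0 exp0n ?muln0 // ltnW.
  case: mm' => E.
    by apply: (succ_pow_neq_pow d x y); rewrite ?(odd_gt0 odd_x) // -?def_m;
      clear - E def_m'; lia.
  by apply: (succ_pow_neq_pow d y x); rewrite ?(odd_gt0 odd_x) // -?def_m;
      clear - E def_m'; lia.
have a_gt4 : 4 < a by apply: leq_trans d_a.
have def_a : a = a.-1.+1 by rewrite prednK // ltnW // ltnW // ltnW // ltnW.
have dvd16 : 16 %| m'.
  by rewrite def_m' dvdn_mulr // (dvdn_exp2l 2 (_ : 4 <= a)) // ltnW.
case: mm' => E.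
  (* 2m + 2 is 4 mod 16 because m is 1 mod 8. *)
  by move/dvdnP: dvd16 => [c Ec]; clear - M8 E Ec; lia.
have Em : m = 2 ^ a.-1 * (u * t ^ k) + 1.
  by move: E; rewrite def_m' {1}def_a expnS -mulnA; clear; lia.
apply: (pow_double_neq x d./2 a u t k); rewrite -?d_def // -?def_m //.
rewrite ltn_neqAle odd_gt0 // andbT; apply/eqP=> x1.
by move: E m'_gt0; rewrite def_m -x1 exp1n; clear; lia.
Qed.

Theorem theorem2 (k p q d : nat) (hp : prime p) (hq : prime q)
  (hk : k = 2 * p * q) (hd : d = gcdn (p - 1) (q - 1)) (hd4 : 4 < d) :
  M k <= 3.
Proof.
rewrite leqNgt; apply/negP=> M_gt3.
have [[n n_gt0 run] _] := MP k.
have tau_run i : i < 4 -> tau (n + i) = 2 * (p * q).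
  by move=> lt_i; rewrite (run i (leq_trans lt_i M_gt3)) hk mulnA.
have [odd_n | even_n] := boolP (odd n).
  apply: (@no_even_pair p q d (n + 1)); rewrite -?addnA ?tau_run ?ltn_addr //.
  by rewrite oddD odd_n.
by apply: (@no_even_pair p q d n); rewrite ?tau_run // -[n]addn0 tau_run.
Qed.
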